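(* Let $C: y=y(x)$ be a smooth regular curve in $A^2$. For a point $P=(x,y(x))\in C$ define the row vectors $$\alpha_1=\left(\frac{-\sqrt3\,(y_xy_{xxx}-3y_{xx}^2)\,|3y_{xx}y_{xxxx}-5y_{xxx}^2|^{1/2}}{9y_{xx}^3},\ \frac{\sqrt3\,y_{xxx}\,|3y_{xx}y_{xxxx}-5y_{xxx}^2|^{1/2}}{9y_{xx}^3}\right),$$ $$\alpha_2=\left(-\frac{y_x}{3y_{xx}^3}|3y_{xx}y_{xxxx}-5y_{xxx}^2|,\ \frac{1}{3y_{xx}^3}|3y_{xx}y_{xxxx}-5y_{xxx}^2|\right).$$ Then $(P,\alpha_1,\alpha_2)$ is a smooth right moving frame on $C$ for the group $Aff^+(2)$ of orientation-preserving affine transformations.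
   Context: $A^2$ is the real affine plane with affine coordinates $(x,y)$; $Aff^+(2)$ is the group of maps $Z\mapsto LZ+v$ with $L\in GL_2(\mathbb R)$, $\det L>0$, $v\in\mathbb R^2$. Subscripts $x$ denote derivatives of $y(x)$. A smooth curve $y=y(x)$, $x$ in an open interval, is regular if $S_1=y_{xx}\neq0$ and $S_2=3y_{xx}y_{xxxx}-5y_{xxx}^2\neq0$ at all of its points. A triple $(P,\alpha_1,\alpha_2)$ with $\alpha_1,\alpha_2$ linearly independent row vectors is identified with the affine transformation $\rho(C,P): Z\mapsto A(Z-P)$, where $A$ is the $2\times 2$ matrix with rows $\alpha_1,\alpha_2$. ''Smooth right moving frame'' means: for every regular curve $C$ and $P\in C$, $\rho(C,P)$ lies in $Aff^+(2)$ and depends smoothly on $P\in C$, and $\rho(gC,gP)=\rho(C,P)\,g^{-1}$ for every $g\in Aff^+(2)$ such that $gC$ is again a graph $y'=y'(x')$ of a smooth function. *)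

(* Defs.v *)
From mathcomp Require Import all_boot all_order all_algebra.
From mathcomp Require Import all_classical all_reals all_analysis.
Set Implicit Arguments.
Unset Strict Implicit.
Unset Printing Implicit Defensive.
Import Order.TTheory GRing.Theory Num.Theory.
Import numFieldNormedType.Exports.
Local Open Scope classical_set_scope.
Local Open Scope ring_scope.

Definition smooth_on (R : realType) (V : normedModType R) (D : set R)
    (f : R -> V) : Prop :=
  forall (n : nat) (x : R), D x -> derivable (f^`(n))%classic x 1.

Definition point (R : realType) (a b : R) : 'cV[R]_2 :=
  \col_(i < 2) (if i == 0 then a else b).

Definition row2 (R : realType) (a b : R) : 'rV[R]_2 :=
  \row_(j < 2) (if j == 0 then a else b).

(* [Affine L v] stands for the map Z |-> L Z + v. *)
Record affine (R : realType) := Affine { lin : 'M[R]_2; trans : 'cV[R]_2 }.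

Definition aff_app (R : realType) (g : affine R) (Z : 'cV[R]_2) : 'cV[R]_2 :=
  lin g *m Z + trans g.

Definition Aff_plus (R : realType) (g : affine R) : Prop := 0 < \det (lin g).

Definition aff_mul (R : realType) (g h : affine R) : affine R :=
  Affine (lin g *m lin h) (lin g *m trans h + trans g).

(* Only meaningful when [lin g] is invertible. *)
Definition aff_inv (R : realType) (g : affine R) : affine R :=
  Affine (invmx (lin g)) (- (invmx (lin g) *m trans g)).

Lemma aff_mulE (R : realType) (g h : affine R) Z :
  aff_app (aff_mul g h) Z = aff_app g (aff_app h Z).
Proof. by rewrite /aff_app /= mulmxDr mulmxA addrA. Qed.

Lemma aff_invK (R : realType) (g : affine R) : Aff_plus g ->
  cancel (aff_app g) (aff_app (aff_inv g)) /\
  cancel (aff_app (aff_inv g)) (aff_app g).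
Proof.
move=> dg; have ug : lin g \in unitmx by rewrite unitmxE unitfE gt_eqF.
split=> Z; rewrite /aff_app /=; first by rewrite mulmxDr mulKmx // addrK.
by rewrite mulmxBr !mulKVmx // addrNK.
Qed.

(* The graph y = fn x, x in dom; the values of [fn] outside [dom] play no
   role. *)
Record curve (R : realType) := Curve { dom : set R; fn : R -> R }.

Definition curve_point (R : realType) (C : curve R) (x : R) : 'cV[R]_2 :=
  point x (fn C x).

Definition curve_set (R : realType) (C : curve R) : set 'cV[R]_2 :=
  curve_point C @` dom C.

Definition smooth_curve (R : realType) (C : curve R) : Prop :=
  [/\ dom C !=set0, open (dom C), is_interval (dom C)
    & smooth_on (dom C) (fn C : R -> R^o)].

Definition yd (R : realType) (C : curve R) (k : nat) (x : R) : R :=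
  ((fn C)^`(k))%classic x.

Definition S1 (R : realType) (C : curve R) (x : R) : R := yd C 2 x.

Definition S2 (R : realType) (C : curve R) (x : R) : R :=
  3 * yd C 2 x * yd C 4 x - 5 * yd C 3 x ^+ 2.

Definition regular_curve (R : realType) (C : curve R) : Prop :=
  smooth_curve C /\ forall x, dom C x -> S1 C x != 0 /\ S2 C x != 0.

Record frame (R : realType) :=
  Frame { base : 'cV[R]_2; cov1 : 'rV[R]_2; cov2 : 'rV[R]_2 }.

Definition frame_mx (R : realType) (F : frame R) : 'M[R]_2 :=
  \matrix_(i < 2) (if i == 0 then cov1 F else cov2 F).

Definition frame_aff (R : realType) (F : frame R) : affine R :=
  Affine (frame_mx F) (- (frame_mx F *m base F)).

Lemma frame_affE (R : realType) (F : frame R) Z :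
  aff_app (frame_aff F) Z = frame_mx F *m (Z - base F).
Proof. by rewrite /aff_app /= mulmxBr. Qed.

(* In the equivariance clause [C'] is any presentation of g C as the graph of a
   smooth function; taking g = 1 shows in particular that the frame depends
   only on the set of points of the curve. *)
Definition smooth_right_moving_frame (R : realType)
    (F : curve R -> 'cV[R]_2 -> frame R) : Prop :=
  let rho C P := frame_aff (F C P) in
  [/\ forall C P, regular_curve C -> curve_set C P ->
        [/\ base (F C P) = P, row_free (frame_mx (F C P))
          & Aff_plus (rho C P)],
      forall C, regular_curve C ->
        smooth_on (dom C) (fun x => lin (rho C (curve_point C x))) /\
        smooth_on (dom C) (fun x => trans (rho C (curve_point C x)))
    & forall C C' g P, regular_curve C -> curve_set C P ->
        Aff_plus g -> smooth_curve C' ->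
        curve_set C' = aff_app g @` curve_set C ->
        rho C' (aff_app g P) = aff_mul (rho C P) (aff_inv g)].

(* [P 0 0] is the x-coordinate of P. *)
Definition alpha1 (R : realType) (C : curve R) (P : 'cV[R]_2) : 'rV[R]_2 :=
  let x := P 0 0 in
  let y1 := yd C 1 x in let y2 := yd C 2 x in
  let y3 := yd C 3 x in let y4 := yd C 4 x in
  row2
    (- Num.sqrt 3 * (y1 * y3 - 3 * y2 ^+ 2) *
       Num.sqrt `|3 * y2 * y4 - 5 * y3 ^+ 2| / (9 * y2 ^+ 3))
    (Num.sqrt 3 * y3 *
       Num.sqrt `|3 * y2 * y4 - 5 * y3 ^+ 2| / (9 * y2 ^+ 3)).

Definition alpha2 (R : realType) (C : curve R) (P : 'cV[R]_2) : 'rV[R]_2 :=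
  let x := P 0 0 in
  let y1 := yd C 1 x in let y2 := yd C 2 x in
  let y3 := yd C 3 x in let y4 := yd C 4 x in
  row2
    (- (y1 / (3 * y2 ^+ 3)) * `|3 * y2 * y4 - 5 * y3 ^+ 2|)
    (1 / (3 * y2 ^+ 3) * `|3 * y2 * y4 - 5 * y3 ^+ 2|).

Definition curve_frame (R : realType) (C : curve R) (P : 'cV[R]_2) : frame R :=
  Frame P (alpha1 C P) (alpha2 C P).

(* Main.v *)
Require Import Defs.
From mathcomp Require Import all_boot all_order all_algebra.
From mathcomp Require Import all_classical all_reals all_analysis.
From mathcomp Require Import ring.
Set Implicit Arguments.
Unset Strict Implicit.
Unset Printing Implicit Defensive.
Import Order.TTheory GRing.Theory Num.Theory.
Import numFieldNormedType.Exports.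
Local Open Scope classical_set_scope.
Local Open Scope ring_scope.

(** Write y1, ..., y4 for the derivatives of y at x, and W = 3 y2 y4 - 5 y3^2.

    The frame is orientation-preserving because the determinant of its matrix
    is sqrt 3 |W|^(3/2) / (9 y2^4), which is positive on a regular curve
    ([det_frame_mx_gt0]).

    It is smooth because its entries are built from the y_k by the field
    operations, by square roots of positive functions and by absolute values
    of nonvanishing functions. The functions built in this way form a class
    ([smooth_expr]) that is closed under differentiation, and a class closed
    under differentiation contains only smooth functions ([smooth_on_coind]).

    For equivariance, let g have linear part ((a, b), (c, d)) and determinant
    del > 0. On C it acts on abscissas by phi(x) = a x + b y(x) + const, with
    derivative D = a + b y1. If y' denotes the function whose graph is gC, then
    y'(phi(x)) = c x + d y(x) + const. Since y' is differentiable at phi(x),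
    the chain rule gives y'_1(phi) D = c + d y1, and D = 0 would make
    the nonzero vector (1, y1) a kernel vector of the linear part of g; so D
    does not vanish. Repeated differentiation then yields ([affine_jet])

      y'_1 = (c + d y1) / D,                     y'_2 = del y2 / D^3,
      y'_3 = del (y3 D - 3 b y2^2) / D^5,        y'_4 = ... / D^7.

    Hence W' = (del / D^4)^2 W: W is a relative invariant with a positive
    square as its multiplier, and |W'|^(1/2) = (del / D^4) |W|^(1/2) because
    del > 0. Up to scalar factors the two covectors are (-y1, 1), which kills
    the tangent vector, and (3 y2^2 - y1 y3, y3); multiplied on the right by
    the linear part of g, their primed versions become del / D and
    del^2 / D^5 times the unprimed ones, and the powers of |W| and y2 in
    alpha2 and alpha1 compensate exactly for these factors, whatever the sign
    of D ([cov1_identity], [cov2_identity]). *)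

(** * Rational identities

    In these identities the letters a, b, c, d are the entries of the linear
    part of an affine map, D is the derivative of the abscissa change, and z1,
    z2, z3 are the derivatives of the transformed function; s stands for
    |W|^(1/2), w for |W| and r for sqrt 3. *)

Lemma frame_det_identity (F : realFieldType) (r s w y1 y2 y3 : F) :
  y2 != 0 ->
  - r * (y1 * y3 - 3 * y2 ^+ 2) * s / (9 * y2 ^+ 3) * (1 / (3 * y2 ^+ 3) * w) -
  r * y3 * s / (9 * y2 ^+ 3) * (- (y1 / (3 * y2 ^+ 3)) * w) =
  r * s * w / (9 * y2 ^+ 4).
Proof. by move=> y20; field. Qed.

Lemma S2_relative_invariant (F : realFieldType) (del D b y2 y3 y4 : F) :
  D != 0 ->
  3 * (del * y2 / D ^+ 3) *
    (del * ((y4 * D - 5 * b * y2 * y3) * D -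
       5 * (y3 * D - 3 * b * y2 ^+ 2) * (b * y2)) / D ^+ 7) -
  5 * (del * (y3 * D - 3 * b * y2 ^+ 2) / D ^+ 5) ^+ 2 =
  (del / D ^+ 4) ^+ 2 * (3 * y2 * y4 - 5 * y3 ^+ 2).
Proof. by move=> D0; field. Qed.

Lemma cov1_identity (F : realFieldType) (a b c d r s y1 y2 y3 : F) :
  let del := a * d - b * c in let D := a + b * y1 in
  let z1 := (c + d * y1) / D in let z2 := del * y2 / D ^+ 3 in
  let z3 := del * (y3 * D - 3 * b * y2 ^+ 2) / D ^+ 5 in
  let s' := del / D ^+ 4 * s in
  let p := - r * (z1 * z3 - 3 * z2 ^+ 2) * s' / (9 * z2 ^+ 3) in
  let q := r * z3 * s' / (9 * z2 ^+ 3) in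
  del != 0 -> D != 0 -> y2 != 0 ->
  p * a + q * c = - r * (y1 * y3 - 3 * y2 ^+ 2) * s / (9 * y2 ^+ 3) /\
  p * b + q * d = r * y3 * s / (9 * y2 ^+ 3).
Proof.
by move=> /= del0 D0 y20; split; field; rewrite ?del0 ?D0 ?y20.
Qed.

Lemma cov2_identity (F : realFieldType) (a b c d w y1 y2 : F) :
  let del := a * d - b * c in let D := a + b * y1 in
  let z1 := (c + d * y1) / D in let z2 := del * y2 / D ^+ 3 in
  let w' := (del / D ^+ 4) ^+ 2 * w in
  let p := - (z1 / (3 * z2 ^+ 3)) * w' in
  let q := 1 / (3 * z2 ^+ 3) * w' in
  del != 0 -> D != 0 -> y2 != 0 ->
  p * a + q * c = - (y1 / (3 * y2 ^+ 3)) * w /\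
  p * b + q * d = 1 / (3 * y2 ^+ 3) * w.
Proof.
by move=> /= del0 D0 y20; split; field; rewrite ?del0 ?D0 ?y20.
Qed.

(** * Derivation rules *)

Lemma is_derive1_add (R : realType) (f g : R -> R) (x df dg : R) :
  is_derive x 1 f df -> is_derive x 1 g dg ->
  is_derive x 1 (fun z => f z + g z) (df + dg).
Proof. by move=> ? ?; exact: is_deriveD. Qed.

Lemma is_derive1_mul (R : realType) (f g : R -> R) (x df dg : R) :
  is_derive x 1 f df -> is_derive x 1 g dg ->
  is_derive x 1 (fun z => f z * g z) (df * g x + f x * dg).
Proof.
move=> hf hg; apply: is_derive_eq (is_deriveM hf hg) _.
by rewrite addrC /GRing.scale /= (mulrC _ df).
Qed.

Lemma is_derive1_inv (R : realType) (f : R -> R) (x df : R) :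
  f x != 0 -> is_derive x 1 f df ->
  is_derive x 1 (fun z => (f z)^-1) (- (f x)^-1 * (f x)^-1 * df).
Proof.
move=> fx hf; have [h1 h2] := hf; apply: DeriveDef.
  exact: derivableV.
rewrite deriveV // h2 /GRing.scale /=.
by rewrite expr2 invfM !mulNr.
Qed.

Lemma is_derive1_sqrtf (R : realType) (f : R -> R) (x df : R) :
  0 < f x -> is_derive x 1 f df ->
  is_derive x 1 (fun z => Num.sqrt (f z)) ((2 * Num.sqrt (f x))^-1 * df).
Proof.
move=> fx hf.
exact: (is_derive1_comp (is_derive1_sqrt fx) hf).
Qed.

Lemma is_derive1_divX (R : realType) (p q : R -> R) (n : nat) (x dp dq : R) :
  q x != 0 -> is_derive x 1 p dp -> is_derive x 1 q dq ->
  is_derive x 1 (fun z => p z / q z ^+ n)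
    ((dp * q x - n%:R * p x * dq) / q x ^+ n.+1).
Proof.
move=> qx hp hq.
have hX : is_derive x 1 (fun z => q z ^+ n) (n%:R * q x ^+ n.-1 * dq).
  by have := is_deriveX n hq; rewrite exprfctE.
have qnx : q x ^+ n != 0 by rewrite expf_neq0.
have hV := @is_derive1_inv _ (fun z => q z ^+ n) _ _ qnx hX.
apply: is_derive_eq (is_derive1_mul hp hV) _.
by case: n {hX hV qnx} => [|n] /=; rewrite ?exprS ?expr0; field;
  rewrite ?qx ?expf_neq0.
Qed.

(** * Smoothness *)

(** A class of functions closed under differentiation contains only smooth
    functions: on D, each iterated derivative agrees with a member of the
    class, hence is derivable. This avoids any formula for the nth derivative
    of a product or a composite. *)
Lemma smooth_on_coind (R : realType) (V : normedModType R) (D : set R)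
    (P : (R -> V) -> Prop) :
  open D ->
  (forall f, P f ->
     exists2 f', P f' & forall x, D x -> is_derive x 1 f (f' x)) ->
  forall f, P f -> smooth_on D f.
Proof.
move=> oD step f Pf.
have near_D x : D x -> \forall z \near x, D z by move=> Dx; exact: open_nbhs_nbhs.
have der n : exists2 h, P h & forall x, D x -> (f^`(n))%classic x = h x.
  elim: n => [|n [h Ph fh]]; first by exists f.
  have [h' Ph' hh'] := step _ Ph; exists h' => // x Dx.
  rewrite derive1nS derive1E (@near_eq_derive _ _ _ _ h) //.
    by have /@derive_val := hh' x Dx.
  by apply: filterS (near_D x Dx) => z /fh.
move=> n x Dx; have [h Ph fh] := der n.
have [h' _ /(_ x Dx) [hx _]] := step _ Ph.
apply: (@near_eq_derivable _ _ _ h) => //.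
by apply: filterS (near_D x Dx) => z /fh.
Qed.

(** Syntactic in the outermost operation, so that closure under
    differentiation is one structural induction. *)
Inductive smooth_expr (R : realType) (D : set R) : (R -> R) -> Prop :=
| SmoothAtom (f : R -> R) : smooth_on D (f : R -> R^o) -> smooth_expr D f
| SmoothId : smooth_expr D (fun x => x)
| SmoothCst c : smooth_expr D (fun=> c)
| SmoothAdd f g : smooth_expr D f -> smooth_expr D g ->
    smooth_expr D (fun x => f x + g x)
| SmoothMul f g : smooth_expr D f -> smooth_expr D g ->
    smooth_expr D (fun x => f x * g x)
| SmoothInv f : (forall x, D x -> f x != 0) -> smooth_expr D f ->
    smooth_expr D (fun x => (f x)^-1)
| SmoothSqrt f : (forall x, D x -> 0 < f x) -> smooth_expr D f ->
    smooth_expr D (fun x => Num.sqrt (f x)).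

Lemma smooth_on_derive1 (R : realType) (V : normedModType R) (D : set R)
    (f : R -> V) : smooth_on D f -> smooth_on D (f^`())%classic.
Proof. by move=> sf n x Dx; rewrite -derive1Sn; exact: sf. Qed.

Lemma smooth_on_is_derive (R : realType) (V : normedModType R) (D : set R)
    (f : R -> V) x : smooth_on D f -> D x ->
  is_derive x 1 f ((f^`())%classic x).
Proof.
by move=> sf Dx; rewrite derive1E; apply: derivableP; exact: (sf 0%N).
Qed.

Lemma smooth_expr_derive (R : realType) (D : set R) (f : R -> R) :
  smooth_expr D f ->
  exists2 f', smooth_expr D f' & forall x, D x -> is_derive x 1 f (f' x).
Proof.
elim=> {f} [f sf||c|f g Sf [f' Sf' hf] Sg [g' Sg' hg]
  |f g Sf [f' Sf' hf] Sg [g' Sg' hg]|f f0 Sf [f' Sf' hf]|f f0 Sf [f' Sf' hf]].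
- exists ((f : R -> R^o)^`())%classic.
    by apply: SmoothAtom; exact: smooth_on_derive1.
  by move=> x Dx; exact: smooth_on_is_derive Dx.
- by exists (fun=> 1) => [|x _]; [exact: SmoothCst|exact: is_derive_id].
- by exists (fun=> 0) => [|x _]; [exact: SmoothCst|exact: is_derive_cst].
- exists (fun x => f' x + g' x); first exact: SmoothAdd.
  by move=> x Dx; apply: is_derive1_add; [exact: hf|exact: hg].
- exists (fun x => f' x * g x + f x * g' x).
    by apply: SmoothAdd; exact: SmoothMul.
  by move=> x Dx; apply: is_derive1_mul; [exact: hf|exact: hg].
- exists (fun x => -1 * ((f x)^-1 * (f x)^-1) * f' x).
    do 2!apply: SmoothMul => //; first exact: SmoothCst.
    by apply: SmoothMul; exact: SmoothInv.
  move=> x Dx; rewrite mulN1r -mulNr.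
  by apply: is_derive1_inv; [exact: f0|exact: hf].
- exists (fun x => (2 * Num.sqrt (f x))^-1 * f' x).
    apply: SmoothMul => //; apply: SmoothInv => [x Dx|].
      by rewrite mulf_neq0 // gt_eqF // sqrtr_gt0 f0.
    by apply: SmoothMul; [exact: SmoothCst|exact: SmoothSqrt].
  by move=> x Dx; apply: is_derive1_sqrtf; [exact: f0|exact: hf].
Qed.

Lemma smooth_expr_opp (R : realType) (D : set R) (f : R -> R) :
  smooth_expr D f -> smooth_expr D (fun x => - f x).
Proof.
move=> sf; rewrite (_ : (fun x => _) = fun x => -1 * f x).
  by apply: SmoothMul => //; exact: SmoothCst.
by apply/funext => x; rewrite mulN1r.
Qed.

Lemma smooth_expr_exp (R : realType) (D : set R) (f : R -> R) (n : nat) :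
  smooth_expr D f -> smooth_expr D (fun x => f x ^+ n).
Proof.
move=> sf; elim: n => [|n ih]; first exact: SmoothCst.
under eq_fun do rewrite exprS.
exact: SmoothMul.
Qed.

(** Absolute values need no constructor of their own: |f| is the square root
    of the positive function f^2. *)
Lemma smooth_expr_norm (R : realType) (D : set R) (f : R -> R) :
  (forall x, D x -> f x != 0) -> smooth_expr D f ->
  smooth_expr D (fun x => `|f x|).
Proof.
move=> f0 sf; under eq_fun do rewrite -sqrtr_sqr.
apply: SmoothSqrt => [x Dx|]; last exact: smooth_expr_exp.
by rewrite exprn_even_gt0 //= f0.
Qed.

Lemma smooth_on_mx (R : realType) (m n : nat) (D : set R)
    (M : R -> 'M[R]_(m.+1, n.+1)) : open D ->
  (forall i j, smooth_expr D (fun x => M x i j)) -> smooth_on D M.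
Proof.
move=> oD; apply: (@smooth_on_coind _ _ _
  (fun M : R -> 'M[R]_(m.+1, n.+1) =>
     forall i j, smooth_expr D (fun x => M x i j))) => // {}M sM.
have /choice[F' hF'] (ij : 'I_m.+1 * 'I_n.+1) : exists f', smooth_expr D f' /\
    forall x, D x -> is_derive x 1 (fun z => M z ij.1 ij.2) (f' x).
  by have [f' ? ?] := smooth_expr_derive (sM ij.1 ij.2); exists f'.
exists (fun x => \matrix_(i, j) F' (i, j) x) => [i j|x Dx].
  have [+ _] := hF' (i, j); congr smooth_expr.
  by apply/funext => x; rewrite mxE.
have dM : derivable M x 1.
  by apply/derivable_mxP => i j; have [_ /(_ x Dx) []] := hF' (i, j).
apply: DeriveDef => //; rewrite derive_mx //.
apply/matrixP => i j; rewrite !mxE.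
by have [_ /(_ x Dx) /@derive_val] := hF' (i, j).
Qed.

(** * Change of parameter *)

(** The chain rule, kept as a product rather than solved for the derivative of
    G: a vanishing dphi would force dH to vanish, and this is how dphi <> 0 is
    obtained for an affine image that is again a graph. *)
Lemma derive1_reparam (R : realType) (D : set R) (G phi H : R -> R)
    (x dphi dH : R) :
  open D -> D x -> (forall z, D z -> G (phi z) = H z) ->
  derivable (G : R -> R^o) (phi x) 1 ->
  is_derive x 1 phi dphi -> is_derive x 1 H dH ->
  ((G : R -> R^o)^`())%classic (phi x) * dphi = dH.
Proof.
move=> oD Dx GH dG hphi hH.
have hG : is_derive (phi x) 1 G (((G : R -> R^o)^`())%classic (phi x)).
  by rewrite derive1E; exact: derivableP.
have h := is_derive1_comp hG hphi.
have e : 'D_1 (G \o phi) x = 'D_1 H x.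
  apply: near_eq_derive => //.
  by apply: filterS (open_nbhs_nbhs (conj oD Dx)) => z /GH.
by move: e; rewrite !derive_val.
Qed.

(** Each further derivative of a reparametrized function costs two powers of
    dphi: one from the quotient rule, one from the chain rule. This is where
    the exponents 1, 3, 5, 7 in [affine_jet] come from; for n = 0 the numerator
    is itself divisible by dphi, whence the exponent 1 rather than 2. *)
Lemma derive1_reparam_divX (R : realType) (D : set R) (G phi dphi p : R -> R)
    (n : nat) (x dp d2phi : R) :
  open D -> D x -> dphi x != 0 ->
  (forall z, D z -> G (phi z) = p z / dphi z ^+ n) ->
  derivable (G : R -> R^o) (phi x) 1 ->
  is_derive x 1 phi (dphi x) -> is_derive x 1 dphi d2phi ->
  is_derive x 1 p dp ->
  ((G : R -> R^o)^`())%classic (phi x) =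
    (dp * dphi x - n%:R * p x * d2phi) / dphi x ^+ n.+2.
Proof.
move=> oD Dx d0 Gp dG hphi hdphi hp.
have := derive1_reparam oD Dx Gp dG hphi (is_derive1_divX n d0 hp hdphi).
by move/(canRL (mulfK d0)) ->; rewrite [in RHS]exprSr invfM mulrA.
Qed.

(** * The frame *)

Lemma mul_row2 (R : realType) (a b : R) (L : 'M[R]_2) :
  row2 a b *m L =
  row2 (a * L 0 0 + b * L 1 0) (a * L 0 1 + b * L 1 1).
Proof.
apply/rowP => j; rewrite !mxE !big_ord_recl big_ord0 addr0 !mxE /=.
have -> : lift ord0 ord0 = 1 :> 'I_2 by exact/val_inj.
case: eqP => [->//|/eqP j0]; have -> : j = 1; last by [].
by apply/val_inj; case: j j0 => [[|[|]]].
Qed.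

Lemma det2 (R : realType) (M : 'M[R]_2) :
  \det M = M 0 0 * M 1 1 - M 0 1 * M 1 0.
Proof.
rewrite (expand_det_row _ 0) !big_ord_recl big_ord0 addr0 /cofactor !det_mx11.
rewrite !mxE /= expr0 expr1 mul1r mulN1r mulrN.
by congr (_ * M _ _ - M _ _ * M _ _); exact/val_inj.
Qed.

Lemma det_frame_mx (R : realType) (C : curve R) (P : 'cV[R]_2) :
  S1 C (P 0 0) != 0 ->
  \det (frame_mx (curve_frame C P)) =
    Num.sqrt 3 * Num.sqrt `|S2 C (P 0 0)| * `|S2 C (P 0 0)| /
      (9 * S1 C (P 0 0) ^+ 4).
Proof.
rewrite /S1 /S2 det2 !mxE /=; exact: frame_det_identity.
Qed.

Lemma det_frame_mx_gt0 (R : realType) (C : curve R) (P : 'cV[R]_2) :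
  S1 C (P 0 0) != 0 -> S2 C (P 0 0) != 0 ->
  0 < \det (frame_mx (curve_frame C P)).
Proof.
move=> y2 w; rewrite det_frame_mx //.
have w0 : 0 < `|S2 C (P 0 0)| by rewrite normr_gt0.
have y40 : 0 < 9 * S1 C (P 0 0) ^+ 4 by rewrite mulr_gt0 // exprn_even_gt0.
by rewrite divr_gt0 // mulr_gt0 // mulr_gt0 // sqrtr_gt0.
Qed.

(** The derivatives are made opaque first, since otherwise [ring] compares
    them up to unfolding of their definition. *)
Ltac ring_jet :=
  repeat match goal with
  | |- context [yd ?C ?k ?z] => generalize (yd C k z) => ?
  end; ring.

(** The prolonged action on 4-jets: the derivatives at the image point of any
    function whose graph is gC. *)
Lemma affine_jet (R : realType) (C C' : curve R) (g : affine R) (x : R) :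
  smooth_curve C -> dom C x -> Aff_plus g -> smooth_curve C' ->
  curve_set C' = aff_app g @` curve_set C ->
  let x' := aff_app g (curve_point C x) 0 0 in
  let D := lin g 0 0 + lin g 0 1 * yd C 1 x in
  let y2 := yd C 2 x in let y3 := yd C 3 x in let y4 := yd C 4 x in
  let b := lin g 0 1 in let del := \det (lin g) in
  [/\ D != 0, yd C' 1 x' = (lin g 1 0 + lin g 1 1 * yd C 1 x) / D,
      yd C' 2 x' = del * y2 / D ^+ 3,
      yd C' 3 x' = del * (y3 * D - 3 * b * y2 ^+ 2) / D ^+ 5 &
      yd C' 4 x' = del * ((y4 * D - 5 * b * y2 * y3) * D
                     - 5 * (y3 * D - 3 * b * y2 ^+ 2) * (b * y2)) / D ^+ 7].
Proof.
move=> [_ oD _ sC] Dx dg [_ _ _ sC'] CC'.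
move: dg; rewrite /Aff_plus det2.
set a := lin g 0 0; set b := lin g 0 1; set c := lin g 1 0; set d := lin g 1 1.
pose phi z := a * z + b * fn C z + trans g 0 0.
pose psi z := c * z + d * fn C z + trans g 1 0.
pose dphi z := a + b * yd C 1 z.
have gE z : aff_app g (curve_point C z) = Defs.point (phi z) (psi z).
  apply/colP => i; rewrite !mxE !big_ord_recl big_ord0 addr0 !mxE /=.
  have -> : lift ord0 ord0 = 1 :> 'I_2 by exact/val_inj.
  case: eqP => [->//|/eqP i0]; have -> // : i = 1.
  by apply/val_inj; case: i i0 => [[|[|]]].
rewrite gE mxE /= => del0; rewrite -/(dphi x).
set del := a * d - b * c in del0 *.
have onC' z : dom C z -> dom C' (phi z) /\ fn C' (phi z) = psi z.
  move=> Dz; have : curve_set C' (Defs.point (phi z) (psi z)).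
    by rewrite CC' -gE; exists (curve_point C z) => //; exists z.
  case=> w Dw /colP e; have := e 0; have := e 1; rewrite !mxE /=.
  by move=> <- <-.
have derC k z : dom C z -> is_derive z 1 (yd C k) (yd C k.+1 z).
  move=> Dz; rewrite /yd derive1nS derive1E.
  by apply: derivableP; exact: sC.
have derC' k z : dom C z -> derivable (yd C' k : R -> R^o) (phi z) 1.
  by move=> /onC'[C'z _]; exact: sC'.
have dcst (r z : R) : is_derive z 1 (fun=> r) 0 by exact: is_derive_cst.
have dadd := @is_derive1_add R; have dmul := @is_derive1_mul R.
have hphi z : dom C z -> is_derive z 1 phi (dphi z).
  move=> Dz; apply: is_derive_eq (dadd _ _ _ _ _ (dadd _ _ _ _ _
    (dmul _ _ _ _ _ (dcst _ z) (is_derive_id z _))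
    (dmul _ _ _ _ _ (dcst _ z) (derC 0%N z Dz))) (dcst _ z)) _.
  by rewrite /dphi; ring_jet.
have hpsi z : dom C z -> is_derive z 1 psi (c + d * yd C 1 z).
  move=> Dz; apply: is_derive_eq (dadd _ _ _ _ _ (dadd _ _ _ _ _
    (dmul _ _ _ _ _ (dcst _ z) (is_derive_id z _))
    (dmul _ _ _ _ _ (dcst _ z) (derC 0%N z Dz))) (dcst _ z)) _.
  by ring_jet.
have hdphi z : dom C z -> is_derive z 1 dphi (b * yd C 2 z).
  move=> Dz; apply: is_derive_eq (dadd _ _ _ _ _ (dcst _ z)
    (dmul _ _ _ _ _ (dcst _ z) (derC 1%N z Dz))) _.
  by ring_jet.
(* If dphi z = 0, then both coordinates a + b y1 and c + d y1 of the image of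
   the tangent vector (1, y1) vanish, contrary to del <> 0. *)
have dphi0 z : dom C z -> dphi z != 0.
  move=> Dz; apply/eqP => e.
  have := derive1_reparam oD Dz (fun z Dz => (onC' z Dz).2)
    (derC' 0%N z Dz) (hphi z Dz) (hpsi z Dz).
  rewrite e mulr0 => /esym e'.
  have : del = 0; last by move/eqP; rewrite gt_eqF.
  have -> : del = d * dphi z - b * (c + d * yd C 1 z).
    by rewrite /del /dphi; ring_jet.
  by rewrite e e' !mulr0 subrr.
(* The product b * yd C 2 z is the derivative of dphi. *)
have step k n (p : R -> R) dp z : dom C z ->
    (forall z, dom C z -> yd C' k (phi z) = p z / dphi z ^+ n) ->
    is_derive z 1 p dp ->
    yd C' k.+1 (phi z) =
      (dp * dphi z - n%:R * p z * (b * yd C 2 z)) / dphi z ^+ n.+2.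
  move=> Dz h hp; rewrite /yd derive1nS.
  exact: (derive1_reparam_divX oD Dz (dphi0 z Dz) h (derC' k z Dz) (hphi z Dz)
    (hdphi z Dz) hp).
have j1 z : dom C z -> yd C' 1 (phi z) = (c + d * yd C 1 z) / dphi z.
  move=> Dz; rewrite (step 0%N 0%N psi _ z Dz _ (hpsi z Dz)).
    by rewrite mulr0n !mul0r subr0 expr2 invfM mulrA mulfK // dphi0.
  by move=> w Dw; rewrite expr0 divr1 /yd /= (onC' w Dw).2.
have hp1 z : dom C z ->
    is_derive z 1 (fun z => c + d * yd C 1 z) (d * yd C 2 z).
  move=> Dz; apply: is_derive_eq (dadd _ _ _ _ _ (dcst _ z)
    (dmul _ _ _ _ _ (dcst _ z) (derC 1%N z Dz))) _.
  by ring_jet.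
have j2 z : dom C z -> yd C' 2 (phi z) = del * yd C 2 z / dphi z ^+ 3.
  move=> Dz; rewrite (step 1%N 1%N _ _ z Dz _ (hp1 z Dz)).
    by rewrite /del /dphi; congr (_ / _); ring_jet.
  by move=> w Dw; rewrite expr1 j1.
have hp2 z : dom C z ->
    is_derive z 1 (fun z => del * yd C 2 z) (del * yd C 3 z).
  move=> Dz; apply: is_derive_eq
    (dmul _ _ _ _ _ (dcst _ z) (derC 2%N z Dz)) _.
  by ring_jet.
have j3 z : dom C z -> yd C' 3 (phi z) =
    del * (yd C 3 z * dphi z - 3 * b * yd C 2 z ^+ 2) / dphi z ^+ 5.
  move=> Dz; rewrite (step 2%N 3%N _ _ z Dz j2 (hp2 z Dz)).
  by congr (_ / _); move: (dphi z) => ?; ring_jet.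
have hp3 z : dom C z -> is_derive z 1
    (fun z => del * (yd C 3 z * dphi z + - (3 * b) * (yd C 2 z * yd C 2 z)))
    (del * (yd C 4 z * dphi z - 5 * b * yd C 2 z * yd C 3 z)).
  move=> Dz; apply: is_derive_eq (dmul _ _ _ _ _ (dcst _ z) (dadd _ _ _ _ _
    (dmul _ _ _ _ _ (derC 3%N z Dz) (hdphi z Dz)) (dmul _ _ _ _ _ (dcst _ z)
       (dmul _ _ _ _ _ (derC 2%N z Dz) (derC 2%N z Dz))))) _.
  by move: (dphi z) => ?; ring_jet.
have j4 z : dom C z -> yd C' 4 (phi z) =
    del * ((yd C 4 z * dphi z - 5 * b * yd C 2 z * yd C 3 z) * dphi z
      - 5 * (yd C 3 z * dphi z - 3 * b * yd C 2 z ^+ 2) * (b * yd C 2 z))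
    / dphi z ^+ 7.
  move=> Dz; rewrite (step 3%N 5%N _ _ z Dz _ (hp3 z Dz)).
    by congr (_ / _); move: (dphi z) => ?; ring_jet.
  by move=> w Dw; rewrite j3 //; congr (_ / _); move: (dphi w) => ?; ring_jet.
by split; [exact: dphi0|exact: j1|exact: j2|exact: j3|exact: j4].
Qed.

(** Equivariance of the linear parts. The sign of D is lost in the even powers
    of D in W', while the sign of del matters: it is positive, so that
    sqrt ((del / D^4)^2) = del / D^4. *)
Lemma curve_frame_equivariant (R : realType) (C C' : curve R) (g : affine R)
    (P : 'cV[R]_2) :
  regular_curve C -> curve_set C P -> Aff_plus g -> smooth_curve C' ->
  curve_set C' = aff_app g @` curve_set C ->
  frame_mx (curve_frame C' (aff_app g P)) *m lin g = frame_mx (curve_frame C P).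
Proof.
move=> [sC rC] [x Dx <-] dg sC' CC'.
have [] := affine_jet sC Dx dg sC' CC'.
have [] := rC x Dx; rewrite /S1 /S2.
have Px : curve_point C x 0 0 = x by rewrite mxE.
have : 0 < \det (lin g) by [].
have -> : frame_mx (curve_frame C' (aff_app g (curve_point C x))) *m lin g =
    \matrix_(i < 2) (if i == 0
       then alpha1 C' (aff_app g (curve_point C x)) *m lin g
       else alpha2 C' (aff_app g (curve_point C x)) *m lin g).
  by apply/row_matrixP => i; rewrite row_mul !rowK /=; case: ifP.
move=> del0 y20 w0 D0 e1 e2 e3 e4.
suff [-> ->] : alpha1 C' (aff_app g (curve_point C x)) *m lin g =
    alpha1 C (curve_point C x) /\
    alpha2 C' (aff_app g (curve_point C x)) *m lin g =
    alpha2 C (curve_point C x) by [].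
have delE := det2 (lin g).
rewrite /alpha1 /alpha2 !mul_row2 Px e1 e2 e3 e4.
move: del0 D0 delE {e1 e2 e3 e4 dg CC'}.
move: (yd C 1 x) (yd C 2 x) (yd C 3 x) (yd C 4 x) y20 w0 => y1 y2 y3 y4 y20 w0.
set a := lin g 0 0; set b := lin g 0 1; set c := lin g 1 0; set d := lin g 1 1.
move: (\det (lin g)) => del del0; set D := a + b * y1 => D0 delE.
rewrite S2_relative_invariant //.
set w := 3 * y2 * y4 - 5 * y3 ^+ 2.
have k0 : 0 <= del / D ^+ 4.
  by apply: divr_ge0; [exact: ltW|exact: exprn_even_ge0].
rewrite normrM (ger0_norm (sqr_ge0 _)) sqrtrM ?sqr_ge0 // sqrtr_sqr.
rewrite (ger0_norm k0).
have del_neq0 : a * d - b * c != 0 by rewrite -delE gt_eqF.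
rewrite delE /D in D0 *.
have [e11 e12] := @cov1_identity _ a b c d (Num.sqrt 3) (Num.sqrt `|w|)
  y1 y2 y3 del_neq0 D0 y20.
have [e21 e22] := @cov2_identity _ a b c d `|w| y1 y2 del_neq0 D0 y20.
by split; congr row2; [exact: e11|exact: e12|exact: e21|exact: e22].
Qed.

Lemma smooth_expr_yd (R : realType) (C : curve R) (k : nat) :
  smooth_curve C -> smooth_expr (dom C) (yd C k).
Proof.
move=> [_ _ _ sC]; apply: SmoothAtom; elim: k => [//|k ih].
rewrite /yd derive1nS; exact: smooth_on_derive1.
Qed.

Lemma smooth_expr_curve_frame (R : realType) (C : curve R) (i j : 'I_2) :
  regular_curve C ->
  smooth_expr (dom C)
    (fun x => frame_mx (curve_frame C (curve_point C x)) i j).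
Proof.
move=> [sC rC].
have sy k := smooth_expr_yd k sC.
have scst c := SmoothCst (dom C) c.
have sw : smooth_expr (dom C)
    (fun x => 3 * yd C 2 x * yd C 4 x - 5 * yd C 3 x ^+ 2).
  by apply: SmoothAdd; last apply: smooth_expr_opp;
    repeat apply: SmoothMul => //; exact: smooth_expr_exp.
have sW : smooth_expr (dom C)
    (fun x => `|3 * yd C 2 x * yd C 4 x - 5 * yd C 3 x ^+ 2|).
  by apply: smooth_expr_norm => // x Dx; have [] := rC x Dx.
have sS : smooth_expr (dom C)
    (fun x => Num.sqrt `|3 * yd C 2 x * yd C 4 x - 5 * yd C 3 x ^+ 2|).
  apply: SmoothSqrt => // x Dx; rewrite normr_gt0.
  by have [] := rC x Dx.
have sV c : c != 0 -> smooth_expr (dom C) (fun x => (c * yd C 2 x ^+ 3)^-1).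
  move=> c0; apply: SmoothInv => [x Dx|].
    by have [y20 _] := rC x Dx; rewrite mulf_neq0 // expf_neq0.
  by apply: SmoothMul => //; exact: smooth_expr_exp.
have sV3 : smooth_expr (dom C) (fun x => (3 * yd C 2 x ^+ 3)^-1).
  by apply: sV; rewrite pnatr_eq0.
have sV9 : smooth_expr (dom C) (fun x => (9 * yd C 2 x ^+ 3)^-1).
  by apply: sV; rewrite pnatr_eq0.
have sq : smooth_expr (dom C)
    (fun x => yd C 1 x * yd C 3 x - 3 * yd C 2 x ^+ 2).
  by apply: SmoothAdd; last apply: smooth_expr_opp;
    repeat apply: SmoothMul => //; exact: smooth_expr_exp.
under eq_fun do rewrite mxE.
case: i => [[|[|//]] i2] /=; under eq_fun do rewrite !mxE.
- case: (j == 0); by do 3?apply: SmoothMul.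
- case: (j == 0); apply: SmoothMul => //; last exact: SmoothMul.
  by apply: smooth_expr_opp; exact: SmoothMul.
Qed.

(** Once the linear parts of rho(gC, gP) and rho(C, P) g^-1 agree, so do the
    translation parts, both maps sending gP to 0. *)
Lemma affine_factor_trans (R : realFieldType) (n : nat) (A A' L : 'M[R]_n)
    (P v : 'cV[R]_n) :
  L \in unitmx -> A' *m L = A ->
  - (A' *m (L *m P + v)) = A *m - (invmx L *m v) - A *m P.
Proof.
move=> uL <-; rewrite mulmxDr mulmxN !mulmxA mulmxK //.
by rewrite opprD addrC.
Qed.

Theorem proposition3p2 (R : realType) :
  smooth_right_moving_frame (@curve_frame R).
Proof.
split.
- move=> C P [sC rC] [x Dx <-].
  have d0 : 0 < \det (frame_mx (curve_frame C (curve_point C x))).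
    have [y20 w0] := rC x Dx.
    by apply: det_frame_mx_gt0; rewrite mxE.
  split=> //.
  by rewrite row_free_unit unitmxE unitfE gt_eqF.
- move=> C rC; have [[_ oD _ _] _] := rC.
  split; apply: smooth_on_mx => // i j; first exact: smooth_expr_curve_frame.
  (* The translation part is - A P, with P = (x, y x). *)
  rewrite (_ : (fun x => _) = fun x =>
    -1 * (frame_mx (curve_frame C (curve_point C x)) i 0 * x +
          frame_mx (curve_frame C (curve_point C x)) i 1 * yd C 0 x)).
    apply: SmoothMul; first exact: SmoothCst.
    apply: SmoothAdd; apply: SmoothMul; try exact: smooth_expr_curve_frame.
      exact: SmoothId.
    by apply: smooth_expr_yd; case: rC.
  apply/funext => x; rewrite [LHS]mxE [in LHS]mxE !big_ord_recl big_ord0 addr0.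
  rewrite mulN1r (ord1 j) /=.
  have -> : lift ord0 ord0 = 1 :> 'I_2 by exact/val_inj.
  by rewrite [curve_point C x ord0 0]mxE [curve_point C x 1 0]mxE /=.
- move=> C C' g P rC CP dg sC' CC'.
  have e := curve_frame_equivariant rC CP dg sC' CC'.
  have ug : lin g \in unitmx by rewrite unitmxE unitfE gt_eqF.
  have e' := canRL (mulmxK ug) e.
  rewrite /frame_aff /aff_mul /aff_inv /=; congr Affine; first exact: e'.
  exact: affine_factor_trans.
Qed.
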